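(* Suppose the power injections follow the Ornstein-Uhlenbeck model, i.e. for every $\mu\in\mathbb R^m$ one has $b_i(x)=\gamma_i(\mu_i-x)$ and $l_i(x)=l_i$ constant, with $\gamma_i,l_i>0$ for $i=1,\dots,m$; put $D=\mathrm{diag}(\gamma_1,\dots,\gamma_m)$, $\mathsf L=\mathrm{diag}(l_1,\dots,l_m)$ and $M_T=\mathsf L^2D^{-1}(I-e^{-2DT})$. Then, as subsets of $\mathcal A$, $$\tilde{\mathcal R}^{(\mathrm{cur})}_{\epsilon,p}=\bigcap_{\ell\in\mathcal L'}\Bigl\{\overline\mu\in\mathcal A:\ |\nu_\ell|\le1-\sqrt{\epsilon\log(1/p)\,C_\ell M_TC_\ell^\top}\Bigr\}.$$ In the particular case $D=\gamma I$ with $\gamma>0$, this simplifies to $$\tilde{\mathcal R}^{(\mathrm{cur})}_{\epsilon,p}=\bigcap_{\ell\in\mathcal L'}\{\overline\mu\in\mathcal A:\ |\nu_\ell|\le1-\beta_\ell\},\qquad \beta_\ell=\sqrt{\frac{(1-e^{-2\gamma T})\,\epsilon\log(1/p)\,\sigma_\ell^2}{\gamma}},\quad \sigma_\ell^2=C_\ell \mathsf L^2C_\ell^\top.$$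
   Context: Network. $\mathcal G=(\mathcal N,\mathcal L)$ is a finite connected graph with nodes $\{0,1,\dots,N\}$, arbitrarily oriented edges (lines) $\ell\in\mathcal L$ and weights $w_\ell>0$. $A\in\mathbb R^{|\mathcal L|\times(N+1)}$ is the incidence matrix ($A_{\ell,i}=1$ if $\ell=(i,j)$, $-1$ if $\ell=(j,i)$, $0$ otherwise), $W=\mathrm{diag}(w_\ell)$, $B=A^\top WA$, $\hat B$ is $B$ with the row and column of node $0$ deleted, $\breve B=\begin{pmatrix}0&0\\0&\hat B^{-1}\end{pmatrix}$, $\Lambda=\mathrm{diag}(1/I_{\ell,\max})$ with constants $I_{\ell,\max}>0$, and $\overline C=\Lambda WA\breve B$. Fix $1\le m\le N$; $C$ consists of columns $1,\dots,m$ of $\overline C$ and $C_D$ of columns $m+1,\dots,N$. For $\overline\mu=(\mu,\mu_D)\in\mathbb R^m\times\mathbb R^{N-m}=\mathbb R^N$ put $y=C_D\mu_D$ and $\nu=C\mu+y$. $C_\ell$ is the $\ell$-th row of $C$ and $\mathcal L'=\{\ell\in\mathcal L: C_\ell\ne0\}$. Admissible initial conditions. $\mathcal A=\{\overline\mu\in\mathbb R^N: |\nu_\ell|\le1 \text{ for all } \ell\in\mathcal L,\ |\nu_\ell|<1\text{ for all }\ell\notin\mathcal L'\}$. Rate function. $T>0$. $H^1_\mu$ is the set of $g:[0,T]\to\mathbb R^m$ with $g(t)=\mu+\int_0^t\phi(s)\,ds$, $\phi\in L_2([0,T])$. For $g\in H^1_\mu$, $\mathcal I_{\mathrm{pow}}(g)=\sum_{i=1}^m\frac12\int_0^T\left(\frac{g_i'-b_i(g_i)}{l_i(g_i)}\right)^2dt$.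 For continuous $f:[0,T]\to\mathbb R^{|\mathcal L|}$, $\|f\|_\infty=\max_{t\in[0,T]}\max_\ell|f_\ell(t)|$. Decay rate and region. $\mathcal I_{\mathrm{cur}}^*(\overline\mu)=\inf\{\mathcal I_{\mathrm{pow}}(g): g\in H^1_\mu,\ \|y+Cg\|_\infty\ge1\}$. For $\epsilon>0$ and $p\in(0,1)$, $\tilde{\mathcal R}^{(\mathrm{cur})}_{\epsilon,p}=\{\overline\mu\in\mathcal A:\mathcal I_{\mathrm{cur}}^*(\overline\mu)\ge-\epsilon\log p\}$. *)

(* Defs.v *)
(* MathComp / MathComp-Analysis. *)
From mathcomp Require Import all_boot all_order all_algebra.
From mathcomp Require Import all_classical all_reals all_analysis.

Set Implicit Arguments.
Unset Strict Implicit.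
Unset Printing Implicit Defensive.

Import Order.TTheory GRing.Theory Num.Theory.
Import numFieldNormedType.Exports.

Local Open Scope classical_set_scope.
Local Open Scope ring_scope.

(* A finite connected graph on {0, ..., N}.  A line is an ordered pair of
   nodes; each edge {i, j} is stored with exactly one of its two orientations,
   which also excludes self-loops (take i = j in [lines_oriented]).
   Vectors and matrices over the lines are indexed by 'I_#|lines|, the index l
   standing for the line [enum_val l]. *)
Record network (R : realType) (N : nat) := Network {
  lines : {set 'I_N.+1 * 'I_N.+1};
  weight : 'I_#|lines| -> R;
  Imax : 'I_#|lines| -> R;
  lines_oriented : forall i j, (i, j) \in lines -> (j, i) \notin lines;
  lines_connected : forall i j,
    connect [rel x y | ((x, y) \in lines) || ((y, x) \in lines)] i j;
  weight_gt0 : forall l, 0 < weight l;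
  Imax_gt0 : forall l, 0 < Imax l
}.

Section Network.
Context (R : realType) (N : nat) (G : network R N).

Definition line := 'I_#|lines G|.

Definition incidence_mx : 'M[R]_(#|lines G|, 1 + N) :=
  \matrix_(l, i) if i == (enum_val l).1 then 1
                 else if i == (enum_val l).2 then -1 else 0.

Definition weight_mx : 'M[R]_#|lines G| := diag_mx (\row_l weight l).

Definition laplacian_mx : 'M[R]_(1 + N) :=
  incidence_mx^T *m weight_mx *m incidence_mx.

Definition Bhat : 'M[R]_N := drsubmx laplacian_mx.

Definition Bbreve : 'M[R]_(1 + N) := block_mx 0 0 0 (invmx Bhat).

Definition Lambda_mx : 'M[R]_#|lines G| := diag_mx (\row_l (Imax l)^-1).

(* Its columns are numbered by the nodes 0, 1, ..., N. *)
Definition Cbar : 'M[R]_(#|lines G|, 1 + N) :=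
  Lambda_mx *m weight_mx *m incidence_mx *m Bbreve.

End Network.

(* Here N = m + d: the nodes 1, ..., m carry the stochastic injections mu and
   the nodes m + 1, ..., m + d the deterministic injections mu_D; mubar is the
   column vector (mu, mu_D). *)
Section Injections.
Context (R : realType) (m d : nat) (G : network R (m + d)).

Definition Cmx : 'M[R]_(#|lines G|, m) := lsubmx (rsubmx (Cbar G)).

Definition CDmx : 'M[R]_(#|lines G|, d) := rsubmx (rsubmx (Cbar G)).

Definition mu_of (mubar : 'cV[R]_(m + d)) : 'cV[R]_m := usubmx mubar.

Definition muD_of (mubar : 'cV[R]_(m + d)) : 'cV[R]_d := dsubmx mubar.

Definition y_of (mubar : 'cV[R]_(m + d)) : 'cV[R]_#|lines G| :=
  CDmx *m muD_of mubar.

Definition nu_of (mubar : 'cV[R]_(m + d)) : 'cV[R]_#|lines G| :=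
  Cmx *m mu_of mubar + y_of mubar.

Definition active_lines : set (line G) := [set l | row l Cmx != 0].

Definition admissible : set 'cV[R]_(m + d) :=
  [set mubar | (forall l, `|nu_of mubar l 0| <= 1) /\
               (forall l, ~ active_lines l -> `|nu_of mubar l 0| < 1)].

End Injections.

Arguments active_lines {R m d} G.

(* Functions on [0, T] are represented by functions on R; only their values on
   [0, T] are used, up to the derivative at the two end points, which does not
   affect the integrals below. *)
Section RateFunction.
Context (R : realType) (T : R).
Local Notation leb := (@lebesgue_measure R).

Definition L2_on (m : nat) (phi : R -> 'cV[R]_m) : Prop :=
  forall i, measurable_fun `[0, T] (fun s => phi s i 0) /\
    (\int[leb]_(s in `[0%R, T]) ((phi s i 0) ^+ 2)%:E < +oo)%E.

Definition H1 (m : nat) (mu : 'cV[R]_m) : set (R -> 'cV[R]_m) :=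
  [set g | exists2 phi : R -> 'cV[R]_m, L2_on phi &
     forall t, t \in `[0, T] -> forall i,
       g t i 0 = mu i 0 + \int[leb]_(s in `[0, t]) phi s i 0].

(* For g in H1, the derivative exists almost everywhere on [0, T]. *)
Definition Ipow (m : nat) (b l : 'I_m -> R -> R) (g : R -> 'cV[R]_m) : \bar R :=
  (\sum_(i < m) (2^-1)%:E *
     \int[leb]_(t in `[0%R, T])
       (((derive1 (fun s => g s i 0) t - b i (g t i 0)) / l i (g t i 0)) ^+ 2)%:E)%E.

Definition supnorm (n : nat) (f : R -> 'cV[R]_n) : \bar R :=
  ereal_sup [set x | exists t k, t \in `[0, T] /\ x = (`|f t k 0|)%:E].

(* The drift b mu and the diffusion coefficient l mu may depend on the initial
   condition mu.  The infimum of the empty set is +oo. *)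
Definition Icur (m d : nat) (G : network R (m + d))
    (b l : 'cV[R]_m -> 'I_m -> R -> R) (mubar : 'cV[R]_(m + d)) : \bar R :=
  ereal_inf [set Ipow (b (mu_of mubar)) (l (mu_of mubar)) g | g in
    H1 (mu_of mubar) `&`
    [set g | (1 <= supnorm (fun t => (y_of G mubar + Cmx G *m g t)%R))%E]].

Definition region (m d : nat) (G : network R (m + d))
    (b l : 'cV[R]_m -> 'I_m -> R -> R) (eps p : R) : set 'cV[R]_(m + d) :=
  [set mubar | admissible G mubar /\
     ((- eps * ln p)%:E <= Icur G b l mubar)%E].

End RateFunction.

(* The matrix exponential sum_k A^k / k!, the limit being taken entrywise. *)
Definition expmx (R : realType) (n : nat) (A : 'M[R]_n) : 'M[R]_n :=
  \matrix_(i, j) lim (series (fun k : nat => (A ^+ k) i j / k`!%:R) @ \oo).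

Definition M_mx (R : realType) (m : nat) (D L : 'M[R]_m) (T : R) : 'M[R]_m :=
  L ^+ 2 *m invmx D *m (1%:M - expmx (- (2 * T) *: D)).

(* Main.v *)
Require Import Defs.
From mathcomp Require Import all_boot all_order all_algebra.
From mathcomp Require Import all_classical all_reals all_analysis.
From mathcomp Require Import measurable_realfun ring lra.
Import Order.TTheory GRing.Theory Num.Theory.
Import numFieldNormedType.Exports.
Local Open Scope classical_set_scope.
Local Open Scope ring_scope.

(** Each coordinate of a path of finite cost solves [h' = - gamma h + u] with
    [h 0 = 0], where the cost is half the integral of [(u / l)^2], so that
    [h t] is the integral of [exp (- gamma (t - s)) u s] over [[0, t]].
    Cauchy-Schwarz then bounds the squared displacement of a line current by
    the cost times [S = C_l M_T C_l^T]; equality holds at time [T] for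
    [u s] proportional to [c l^2 exp (- gamma (T - s))].  Hence
    the decay rate is the minimum of [(1 - |nu_l|)^2 / S] over the lines
    with [C_l <> 0], and such lines exist because the reduced Laplacian of a
    connected graph is invertible. *)

Section OrnsteinUhlenbeck.
Context {R : realType}.
Local Notation leb := (@lebesgue_measure R).

(** * Integration over segments *)

(* The upper function need not be measurable: its integral is then a lower
   integral. This matters because [derive1] of a path is only known almost
   everywhere. *)
Lemma le_integral_ae (D : set R) (w : R -> R) (F : R -> \bar R) :
  measurable D -> measurable_fun D w -> (forall x, (0 <= F x)%E) ->
  {ae leb, forall x, D x -> ((w x)%:E <= F x)%E} ->
  (\int[leb]_(x in D) (w x)%:E <= \int[leb]_(x in D) F x)%E.
Proof.
move=> mD mw F0 [N [mN N0 subN]].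
have mw' := (measurable_EFinP D w).2 mw.
have mwp := measurable_funepos mw'.
rewrite integralE.
apply: (@le_trans _ _ (\int[leb]_(x in D) (EFin \o w)^\+ x)%E).
  by rewrite -[leRHS]sube0; apply: leeB => //; exact: integral_ge0.
rewrite (ge0_negligible_integral mN)//.
rewrite integral_mkcond [leRHS]integral_mkcond.
rewrite !ge0_integralTE; last 2 first.
- by move=> x; rewrite patchE; case: ifP.
- by move=> x; rewrite patchE; case: ifP.
(* Both integrals are suprema over simple functions, and one lying below the positive part of [w]
   off the null set also lies below [F], because [F] is nonnegative. *)
apply: le_ereal_sup => _ [h /= hw <-]; exists h => // x.
apply: (le_trans (hw x)); rewrite !patchE.
case: ifPn => [|_]; last by case: ifPn.
rewrite inE => -[Dx Nx]; rewrite mem_set// funeposE ge_max F0 andbT.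
by apply: contrapT => H; apply: Nx; apply: subN => /= /(_ Dx).
Qed.

Lemma Rintegral_derive (F f : R -> R) (a b : R) : a <= b ->
  (forall x : R, is_derive x 1 F (f x)) -> continuous f ->
  \int[leb]_(x in `[a, b]) f x = F b - F a.
Proof.
rewrite le_eqVlt => /predU1P[<- _ _|ab dF cf].
  by rewrite set_itv1 Rintegral_set1 subrr.
have dF' x : derivable F x 1 by case: (dF x).
have cF : continuous F.
  by move=> x; apply: differentiable_continuous; apply/derivable1_diffP.
rewrite /Rintegral (@continuous_FTC2 _ f F)//.
- exact: continuous_subspaceT.
- split=> //.
  + exact/cvg_at_right_filter/cF.
  + exact/cvg_at_left_filter/cF.
- by move=> x _; rewrite derive1E; case: (dF x).
Qed.

Lemma continuous_integrable_itv (f : R -> R) (a b : R) :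
  continuous f -> leb.-integrable `[a, b] (EFin \o f).
Proof.
move=> cf; apply: continuous_compact_integrable; first exact: segment_compact.
exact: continuous_subspaceT.
Qed.

Lemma EFin_Rintegral (D : set R) (f : R -> R) : measurable D ->
  leb.-integrable D (EFin \o f) ->
  (\int[leb]_(x in D) (f x)%:E)%E = (\int[leb]_(x in D) f x)%:E.
Proof. by move=> mD If; rewrite /Rintegral fineK// integrable_fin_num. Qed.

Lemma integrable_EFinZl (D : set R) (c : R) (f : R -> R) : measurable D ->
  leb.-integrable D (EFin \o f) ->
  leb.-integrable D (EFin \o (fun x => c * f x)).
Proof.
move=> mD If; rewrite (_ : EFin \o _ = (fun x => c%:E * (EFin \o f) x)%E)//.
exact: integrableZl.
Qed.

Lemma integrable_EFinD (D : set R) (f g : R -> R) : measurable D ->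
  leb.-integrable D (EFin \o f) -> leb.-integrable D (EFin \o g) ->
  leb.-integrable D (EFin \o (fun x => f x + g x)).
Proof.
move=> mD If Ig.
rewrite (_ : EFin \o _ = ((EFin \o f) \+ (EFin \o g))%E)//.
exact: integrableD.
Qed.

(** Fubini on the triangle [0 <= r <= s <= t]: the two sides are the iterated integrals of
    [f r * k s] in the two orders. It replaces integration by parts for a primitive that is
    differentiable only almost everywhere. *)
Lemma Rintegral_triangle (f k : R -> R) (t : R) :
  leb.-integrable `[0, t] (EFin \o f) -> leb.-integrable `[0, t] (EFin \o k) ->
  \int[leb]_(s in `[0, t]) ((\int[leb]_(r in `[0, s]) f r) * k s) =
  \int[leb]_(r in `[0, t]) (f r * \int[leb]_(s in `[r, t]) k s).
Proof.
move=> If Ik.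
pose f' := f \_ `[0, t]; pose k' := k \_ `[0, t].
have If' : leb.-integrable setT (EFin \o f').
  by move: If; rewrite integrable_mkcond//= restrict_EFin.
have Ik' : leb.-integrable setT (EFin \o k').
  by move: Ik; rewrite integrable_mkcond//= restrict_EFin.
have mf' : measurable_fun setT f'.
  by apply/measurable_EFinP; exact: measurable_int If'.
have mk' : measurable_fun setT k'.
  by apply/measurable_EFinP; exact: measurable_int Ik'.
(* The integrand is extended by zero to the whole plane, with the order relation as a 0-1 factor. *)
pose H (z : measurableTypeR R * measurableTypeR R) : R :=
  f' z.1 * k' z.2 * (if z.1 <= z.2 then 1 else 0).
have mH : measurable_fun setT H.
  apply: measurable_funM.
    by apply: measurable_funM; exact: measurableT_comp.
  by apply: measurable_fun_ifT => //; exact: measurable_fun_ler.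
have mG : measurable_fun setT
    (fun z : measurableTypeR R * measurableTypeR R => f' z.1 * k' z.2).
  by apply: measurable_funM; exact: measurableT_comp.
(* Domination by the full product, whose absolute integral factors into two finite integrals. *)
have IH : (leb \x leb)%E.-integrable setT (EFin \o H).
  apply: (@le_integrable _ _ _ _ _ _ (EFin \o H)
    (fun z => (f' z.1 * k' z.2)%:E)) => //.
  - exact/measurable_EFinP.
  - move=> z _; rewrite /H /= lee_fin; case: ifP => _; first by rewrite mulr1.
    by rewrite mulr0 normr0.
  apply/integrable12ltyP; first exact/measurable_EFinP.
  have [_ If2] := integrableP _ _ _ If'.
  have [mk2 Ik2] := integrableP _ _ _ Ik'.
  have K0 : (0 <= \int[leb]_x `|(EFin \o k') x|)%E by exact: integral_ge0.
  have Kfin : (\int[leb]_x `|(EFin \o k') x|)%E \is a fin_num.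
    by rewrite ge0_fin_numE.
  rewrite (_ : (\int[leb]_x _)%E = (\int[leb]_x (`|(EFin \o f') x| *
     (fine (\int[leb]_x `|(EFin \o k') x|))%:E))%E); last first.
    apply: eq_integral => x _; rewrite fineK// -ge0_integralZl//.
    + by apply: eq_integral => y _ /=; rewrite normrM EFinM.
    + exact: measurableT_comp.
  rewrite ge0_integralZr//; last 2 first.
  + by apply: measurableT_comp => //; exact/measurable_EFinP.
  + by rewrite lee_fin fine_ge0.
  have Ffin : (\int[leb]_x `|(EFin \o f') x|)%E \is a fin_num.
    by rewrite ge0_fin_numE// integral_ge0.
  by rewrite lte_mul_pinfty ?integral_ge0// ltey.
have := Fubini IH => /=.
have -> : (\int[leb]_x \int[leb]_y (H (x, y))%:E)%E =
   (\int[leb]_(r in `[0%R, t]) (f r * \int[leb]_(s in `[r, t]) k s)%:E)%E.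
  rewrite [RHS]integral_mkcond; apply: eq_integral => r _.
  rewrite patchE; case: ifPn => r0t; last first.
    apply: integral0_eq => s _; rewrite /H /= /f' patchE (negbTE r0t).
    by rewrite !mul0r.
  have rt : `[r, t]%classic `<=` `[0, t]%classic.
    by move: r0t; rewrite inE/= in_itv/= => /andP[r0 _]; exact: subset_itvr.
  have Ikr : leb.-integrable `[r, t] (EFin \o k) by exact: integrableS Ik.
  rewrite -RintegralZl// -EFin_Rintegral//; last first.
    exact: integrable_EFinZl.
  rewrite [RHS]integral_mkcond; apply: eq_integral => s _.
  rewrite /H /= /f' /k' !patchE r0t; case: ifPn => s0t; last first.
    rewrite memNset ?mulr0 ?mul0r// => /rt s1.
    by move: s0t; rewrite notin_setE; exact.
  have [rs|sr] := leP r s; last first.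
    by rewrite memNset/= ?in_itv/= ?leNgt ?sr ?mulr0.
  move: s0t; rewrite mulr1 inE/= in_itv/= => /andP[_ st].
  by rewrite mem_set//= in_itv/= rs.
have -> : (\int[leb]_y \int[leb]_x (H (x, y))%:E)%E =
   (\int[leb]_(s in `[0%R, t]) ((\int[leb]_(r in `[0, s]) f r) * k s)%:E)%E.
  rewrite [RHS]integral_mkcond; apply: eq_integral => s _.
  rewrite patchE; case: ifPn => s0t; last first.
    apply: integral0_eq => r _; rewrite /H /= /k' patchE (negbTE s0t).
    by rewrite mulr0 mul0r.
  have st : `[0, s]%classic `<=` `[0, t]%classic.
    by move: s0t; rewrite inE/= in_itv/= => /andP[_ st]; exact: subset_itvl.
  have Ifs : leb.-integrable `[0, s] (EFin \o f) by exact: integrableS If.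
  rewrite mulrC -RintegralZl// -EFin_Rintegral//; last exact: integrable_EFinZl.
  rewrite [RHS]integral_mkcond; apply: eq_integral => r _.
  rewrite /H /= /f' /k' !patchE s0t; case: ifPn => r0t; last first.
    by rewrite memNset ?mul0r// => /st s1; move: r0t; rewrite notin_setE; exact.
  have [rs|sr] := leP r s; last first.
    by rewrite memNset/= ?in_itv/= ?leNgt ?sr ?andbF ?mulr0.
  move: r0t; rewrite mulr1 mulrC inE/= in_itv/= => /andP[r0 _].
  by rewrite mem_set//= in_itv/= rs r0.
by rewrite /Rintegral => ->.
Qed.

Lemma integrable_EFinM_continuous (a b : R) (c f : R -> R) : continuous c ->
  leb.-integrable `[a, b] (EFin \o f) ->
  leb.-integrable `[a, b] (EFin \o (fun x => c x * f x)).
Proof.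
move=> cc If; rewrite (_ : EFin \o _ = ((EFin \o c) \* (EFin \o f))%E)//.
apply: integrableMr => //.
- apply: measurable_funS (continuous_measurable_fun cc) => //.
- have : compact (c @` `[a, b]).
    apply: continuous_compact; last exact: segment_compact.
    exact: continuous_subspaceT.
  move=> /compact_bounded [M [Mr HM]]; exists M; split=> // x Mx y yab.
  by apply: HM => //; exists y.
Qed.

Lemma integrable_primitive (t : R) (f : R -> R) : 0 <= t ->
  leb.-integrable `[0, t] (EFin \o f) ->
  leb.-integrable `[0, t] (EFin \o (fun s => \int[leb]_(r in `[0, s]) f r)).
Proof.
move=> t0 If; apply: continuous_compact_integrable.
  exact: segment_compact.
exact: parameterized_integral_continuous.
Qed.

(** * Exponentials and variation of constants *)

Lemma continuous_expR_lin (c : R) : continuous (fun s => expR (c * s)).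
Proof.
move=> s; apply: continuous_comp; last exact: continuous_expR.
by apply: cvgM; [exact: cvg_cst|exact: cvg_id].
Qed.

Lemma is_derive_expR_lin (c s : R) :
  is_derive s 1 (fun s => expR (c * s)) (c * expR (c * s)).
Proof.
have H : is_derive s 1 (fun s : R => c * s) c.
  by rewrite -[X in is_derive _ _ _ X]mulr1; exact: is_deriveZ.
have := @is_derive1_comp _ expR (fun s => c * s) s _ _
  (is_derive_expR (c * s)) H.
by rewrite /comp mulrC.
Qed.

Lemma Rintegral_expR_lin (c a b : R) : a <= b ->
  \int[leb]_(s in `[a, b]) (c * expR (c * s)) = expR (c * b) - expR (c * a).
Proof.
move=> ab; apply: (Rintegral_derive (fun s => expR (c * s))) => //.
  by move=> s; exact: is_derive_expR_lin.
by move=> s; apply: cvgM; [exact: cvg_cst|exact: continuous_expR_lin].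
Qed.

(** Formally the integrand is the derivative of [expR (gamma * s)] times the primitive of [f].
    Exchanging the order of integration in the second summand avoids a product rule for absolutely
    continuous functions. *)
Lemma variation_of_constants (gamma t : R) (f : R -> R) : 0 <= t ->
  leb.-integrable `[0, t] (EFin \o f) ->
  \int[leb]_(s in `[0, t])
    (expR (gamma * s) * (f s + gamma * \int[leb]_(r in `[0, s]) f r)) =
  expR (gamma * t) * \int[leb]_(s in `[0, t]) f s.
Proof.
move=> t0 If.
have Ik : leb.-integrable `[0, t] (EFin \o (fun s => gamma * expR (gamma * s))).
  apply: continuous_integrable_itv => s.
  by apply: cvgM; [exact: cvg_cst|exact: continuous_expR_lin].
have tri := Rintegral_triangle _ _ _ If Ik.
have Ief := integrable_EFinM_continuous _ _ _ _ (continuous_expR_lin gamma) If.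
have IF := integrable_primitive _ _ t0 If.
have IeF := integrable_EFinM_continuous _ _ _ _ (continuous_expR_lin gamma)
  (integrable_EFinZl _ gamma _ (measurable_itv _) IF).
transitivity (\int[leb]_(s in `[0, t]) (expR (gamma * s) * f s) +
   \int[leb]_(s in `[0, t])
     (expR (gamma * s) * (gamma * \int[leb]_(r in `[0, s]) f r))).
  by rewrite -RintegralD//; apply: eq_Rintegral => s _; rewrite mulrDr.
(* After the exchange, the inner integral of [gamma * expR (gamma * s)] is a difference of
   exponentials; its lower end cancels the first summand. *)
rewrite [X in _ + X](_ : _ = \int[leb]_(s in `[0, t])
   (expR (gamma * t) * f s + -1 * (expR (gamma * s) * f s))); last first.
  transitivity (\int[leb]_(s in `[0, t])
    ((\int[leb]_(r in `[0, s]) f r) * (gamma * expR (gamma * s)))).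
    by apply: eq_Rintegral => s _; rewrite mulrC -mulrA mulrCA.
  rewrite tri; apply: eq_Rintegral => s.
  rewrite inE/= in_itv/= => /andP[_ st].
  by rewrite Rintegral_expR_lin//; ring.
rewrite RintegralD//; last 2 first.
- exact: integrable_EFinZl.
- exact: integrable_EFinZl.
by rewrite !RintegralZl//; ring.
Qed.

(** * Almost everywhere derivatives and the energy of one coordinate *)

Lemma ae_neq (a : R) : {ae leb, forall x, x != a}.
Proof.
exists [set a]; split; [exact: measurable_set1|exact: lebesgue_measure_set1|].
by move=> x /= /negP; rewrite negbK => /eqP.
Qed.

(** Lebesgue differentiation gives this at almost every interior point. The end points are
    discarded, since [g] is arbitrary outside the segment and [derive1] is two-sided. *)
Lemma ae_derive1_primitive (T c : R) (f g : R -> R) :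
  leb.-integrable `[0, T] (EFin \o f) ->
  (forall t, t \in `[0, T] -> g t = c + \int[leb]_(s in `[0, t]) f s) ->
  {ae leb, forall x, `[0, T]%classic x -> derive1 g x = f x}.
Proof.
move=> If gE.
pose f' := f \_ `[0, T].
have lf : locally_integrable [set: R] f' by exact: integrable_locally.
apply: filterS3 (lebesgue_differentiation lf) (ae_neq 0) (ae_neq T).
  exact: (ae_filter_ringOfSetsType leb).
move=> x fx xn0 xnT /=; rewrite in_itv/= => /andP[x0 xT].
have {xn0}x0 : 0 < x by rewrite lt_neqAle eq_sym xn0.
have {xnT}xT : x < T by rewrite lt_neqAle xnT.
have If' : leb.-integrable `[0, T] (EFin \o f').
  apply: eq_integrable If => // y yT.
  by rewrite /= /f' patchE yT.
have [] := @FTC1_lebesgue_pt _ f' (BLeft 0) x T xT If' _ fx.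
  by rewrite lte_fin.
set F := (fun y : R => _) => dF; rewrite {1}/f' patchE mem_set/=; last first.
  by rewrite in_itv/= !ltW.
move=> <-.
rewrite !derive1E.
have Fg : \near x, (F x + c) = g x.
  near=> y.
  have y0 : 0 < y by near: y; exact: lt_nbhsr.
  have yT : y < T by near: y; exact: lt_nbhsl.
  rewrite gE ?in_itv/= ?ltW// addrC; congr (_ + _).
  apply: eq_Rintegral => s; rewrite inE/= in_itv/= => /andP[s0 sy].
  by rewrite /f' patchE mem_set//= in_itv/= s0 (le_trans sy)// ltW.
rewrite -(near_eq_derive _ Fg).
rewrite (_ : (fun x => F x + c) = F + cst c)//.
by rewrite (deriveD dF (derivable_cst _ _ _)) derive_cst addr0.
Unshelve. all: by end_near. Qed.

(** With the control [u = f + gamma * h], integrate over [[0, t]] the inequality saying that the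
    square of [u / lambda - q * lambda * expR (- gamma * (t - s))] is nonnegative. Keeping [q] free
    makes the bound linear in the displacement, so that coordinates can be added before
    optimising. *)
Lemma ou_energy_ge (gamma lambda T t q c : R) (f g : R -> R) :
  0 < gamma -> 0 < lambda -> t \in `[0, T] ->
  leb.-integrable `[0, T] (EFin \o f) ->
  (forall s, s \in `[0, T] -> g s = c + \int[leb]_(r in `[0, s]) f r) ->
  ((2 * q * (g t - c) -
     q ^+ 2 * (lambda ^+ 2 * (1 - expR (- (2 * gamma * T))) /
               (2 * gamma)))%:E <=
   \int[leb]_(s in `[0%R, T])
     (((derive1 g s - gamma * (c - g s)) / lambda) ^+ 2)%:E)%E.
Proof.
move=> g0 l0 /[dup] tT; rewrite in_itv/= => /andP[t0 tT'] If gE.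
have tsub : `[0, t]%classic `<=` `[0, T]%classic by exact: subset_itvl.
have Ift : leb.-integrable `[0, t] (EFin \o f) by exact: integrableS If.
pose h s := \int[leb]_(r in `[0, s]) f r.
(* [A] and [B] are the coefficients that make [(u / lambda) ^+ 2 - w s] a perfect square. *)
pose A := 2 * q * expR (- (gamma * t)).
pose B := - (q ^+ 2 * lambda ^+ 2 * expR (- (2 * gamma * t)) / (2 * gamma)).
pose w s := A * (expR (gamma * s) * (f s + gamma * h s)) +
            B * (2 * gamma * expR (2 * gamma * s)).
have Ih : leb.-integrable `[0, t] (EFin \o h) by exact: integrable_primitive.
have Iu : leb.-integrable `[0, t]
    (EFin \o (fun s => expR (gamma * s) * (f s + gamma * h s))).
  apply: integrable_EFinM_continuous; first exact: continuous_expR_lin.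
  by apply: integrable_EFinD => //; exact: integrable_EFinZl.
have Ie : leb.-integrable `[0, t]
    (EFin \o (fun s => 2 * gamma * expR (2 * gamma * s))).
  apply: integrable_EFinZl => //; apply: continuous_integrable_itv.
  exact: continuous_expR_lin.
have IAu := integrable_EFinZl _ A _ (measurable_itv _) Iu.
have IBe := integrable_EFinZl _ B _ (measurable_itv _) Ie.
have Iw : leb.-integrable `[0, t] (EFin \o w) by exact: integrable_EFinD.
have ww : (\int[leb]_(s in `[0, t]) w s)%R = 2 * q * (g t - c) -
  q ^+ 2 * (lambda ^+ 2 * (1 - expR (- (2 * gamma * t))) / (2 * gamma)).
  rewrite /w RintegralD// RintegralZl// RintegralZl//.
  rewrite variation_of_constants// Rintegral_expR_lin// gE// addrAC subrr add0r.
  rewrite mulr0 expR0 mulrA /A -(mulrA (2 * q)) -expRD addNr expR0 mulr1.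
  congr (_ + _).
  by rewrite /B expRN; field; rewrite !gt_eqF ?expR_gt0.
(* The subtracted term grows with time, so its value at [t] may be replaced by the one at [T]. *)
apply: (@le_trans _ _ (\int[leb]_(s in `[0, t]) w s)%:E).
  rewrite ww lee_fin lerB// ler_wpM2l ?sqr_ge0//.
  rewrite ler_wpM2r//; first by rewrite invr_ge0 mulr_ge0// ltW.
  rewrite ler_wpM2l ?sqr_ge0// lerB// ler_expR lerN2.
  by rewrite ler_wpM2l// mulr_ge0// ltW.
rewrite -EFin_Rintegral//.
(* Past [t] the minorant is zero, and the energy spent there is simply dropped. *)
rewrite (_ : (\int[leb]_(s in `[0%R, t]) (w s)%:E)%E =
  (\int[leb]_(s in `[0%R, T]) ((w \_ `[0%R, t]) s)%:E)%E); last first.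
  rewrite -[in LHS](setIidr tsub) integral_mkcondr.
  by apply: eq_integral => s _; rewrite !patchE; case: ifP.
apply: le_integral_ae => //.
- apply/measurable_restrict => //.
  by rewrite setIidr//; apply/measurable_EFinP; exact: measurable_int Iw.
- by move=> x; rewrite lee_fin sqr_ge0.
apply: filterS (ae_derive1_primitive _ _ _ _ If gE).
  exact: (ae_filter_ringOfSetsType leb).
move=> s sE sT.
rewrite lee_fin patchE; case: ifPn => [|_]; last exact: sqr_ge0.
rewrite inE => st; rewrite sE// (gE s)// -/(h s).
rewrite (_ : c - (c + h s) = - h s); last by ring.
rewrite mulrN opprK /w.
set u := f s + gamma * h s.
rewrite -subr_ge0.
rewrite (_ : _ - _ = (u / lambda -
  q * lambda * expR (- (gamma * t)) * expR (gamma * s)) ^+ 2).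
  exact: sqr_ge0.
rewrite /A /B.
have -> : expR (- (2 * gamma * t)) = expR (- (gamma * t)) ^+ 2.
  by rewrite expr2 -expRD; congr expR; ring.
have -> : expR (2 * gamma * s) = expR (gamma * s) ^+ 2.
  by rewrite expr2 -expRD; congr expR; ring.
field.
by rewrite !gt_eqF.
Qed.

(** * Extremal paths *)

(* The control [g' - gamma (c - g) = a * expR (gamma t)] realises equality in
   the Cauchy-Schwarz inequality behind [ou_energy_ge]. *)
Definition ou_path (gamma a c t : R) : R :=
  c + a / (2 * gamma) * (expR (gamma * t) - expR (- gamma * t)).

Definition ou_speed (gamma a t : R) : R :=
  a / 2 * (expR (gamma * t) + expR (- gamma * t)).

Lemma is_derive_ou_path (gamma a c t : R) : 0 < gamma ->
  is_derive t 1 (ou_path gamma a c) (ou_speed gamma a t).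
Proof.
move=> g0.
have := is_deriveD (is_derive_cst c t 1)
  (is_deriveZ (a / (2 * gamma)) (is_deriveB (is_derive_expR_lin gamma t)
                                 (is_derive_expR_lin (- gamma) t))).
rewrite (_ : (_ + _ : R -> R) = ou_path gamma a c)//.
rewrite (_ : (_ + _ : R) = ou_speed gamma a t)//.
rewrite /ou_speed /GRing.scale/= add0r; field.
by rewrite gt_eqF.
Qed.

Lemma continuous_ou_speed (gamma a : R) : continuous (ou_speed gamma a).
Proof.
move=> t; apply: cvgM; first exact: cvg_cst.
by apply: cvgD; exact: continuous_expR_lin.
Qed.

Lemma ou_pathE (gamma a c t : R) : 0 < gamma -> 0 <= t ->
  ou_path gamma a c t = c + \int[leb]_(s in `[0, t]) ou_speed gamma a s.
Proof.
move=> g0 t0; rewrite (Rintegral_derive _ _ _ _ t0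
  (fun x => is_derive_ou_path gamma a c x g0) (continuous_ou_speed gamma a)).
by rewrite {2 3}/ou_path !mulr0 expR0 subrr mulr0 addr0 addrCA subrr addr0.
Qed.

Lemma ou_path_energy (gamma lambda T a c : R) :
  0 < gamma -> 0 < lambda -> 0 <= T ->
  (\int[leb]_(s in `[0%R, T])
     (((derive1 (ou_path gamma a c) s - gamma * (c - ou_path gamma a c s)) /
       lambda) ^+ 2)%:E)%E =
  (a ^+ 2 / lambda ^+ 2 * ((expR (2 * gamma * T) - 1) / (2 * gamma)))%:E.
Proof.
move=> g0 l0 T0.
pose k := a ^+ 2 / lambda ^+ 2 / (2 * gamma).
have gn0 : gamma != 0 by rewrite gt_eqF.
have ln0 : lambda != 0 by rewrite gt_eqF.
(* The decaying exponentials of the speed and of the drift cancel, which leaves the control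
   [a * expR (gamma * s)]. *)
transitivity (\int[leb]_(s in `[0%R, T])
    (k * (2 * gamma * expR (2 * gamma * s)))%:E)%E.
  apply: eq_integral => s _; congr EFin.
  rewrite derive1E.
  rewrite (@derive_val _ _ _ _ _ _ _ (is_derive_ou_path gamma a c s g0)).
  rewrite /k /ou_path /ou_speed.
  have -> : expR (2 * gamma * s) = expR (gamma * s) ^+ 2.
    by rewrite expr2 -expRD; congr expR; ring.
  by field; rewrite gn0.
have Ie : leb.-integrable `[0, T]
    (EFin \o (fun s => 2 * gamma * expR (2 * gamma * s))).
  apply: integrable_EFinZl => //; apply: continuous_integrable_itv.
  exact: continuous_expR_lin.
rewrite EFin_Rintegral//; last exact: integrable_EFinZl.
rewrite RintegralZl// Rintegral_expR_lin// mulr0 expR0 /k.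
by congr EFin; field; rewrite gn0.
Qed.

(** * Diagonal matrices and the matrix [M_T] *)

Lemma exprmx_diag (m : nat) (d : 'rV[R]_m) (k : nat) :
  (diag_mx d) ^+ k = diag_mx (\row_i (d 0 i ^+ k)).
Proof.
elim: k => [|k IH].
  by rewrite expr0; apply/matrixP => i j; rewrite !mxE expr0.
rewrite exprS IH; apply/matrixP => i j.
by rewrite -[_ * _]/(_ *m _) mul_diag_mx !mxE mulrnAr -exprS.
Qed.

Lemma expmx_diag (m : nat) (d : 'rV[R]_m) :
  expmx (diag_mx d) = diag_mx (\row_i expR (d 0 i)).
Proof.
apply/matrixP => i j; rewrite !mxE.
have -> : (fun k : nat => (diag_mx d ^+ k) i j / k`!%:R) =
    (fun k => (d 0 i ^+ k / k`!%:R) *+ (i == j)).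
  by apply/funext => k; rewrite exprmx_diag !mxE mulrnAl.
(* On the diagonal the series is the one that defines [expR]; off the diagonal every term is
   zero. *)
case: (i == j); rewrite /= ?mulr1n; first done.
rewrite (_ : series _ = cst 0) ?lim_cst//.
by apply/funext => n; rewrite /series/= big1.
Qed.

Lemma invmx_diag (m : nat) (d : 'rV[R]_m) : (forall i, d 0 i != 0) ->
  invmx (diag_mx d) = diag_mx (\row_i (d 0 i)^-1).
Proof.
move=> d0.
have E : diag_mx d *m diag_mx (\row_i (d 0 i)^-1) = 1%:M.
  by rewrite mulmx_diag; apply/matrixP => i j; rewrite !mxE divff.
have [U _] := mulmx1_unit E.
by rewrite -[RHS](mulKmx U) E mulmx1.
Qed.

Lemma quadratic_diag (m : nat) (u d : 'rV[R]_m) :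
  (u *m diag_mx d *m u^T) 0 0 = \sum_i u 0 i ^+ 2 * d 0 i.
Proof.
rewrite mxE; apply: eq_bigr => i _.
by rewrite mul_mx_diag !mxE; ring.
Qed.

Lemma M_mx_diag (m : nat) (gam lam : 'I_m -> R) (T : R) :
  (forall i, 0 < gam i) ->
  M_mx (diag_mx (\row_i gam i)) (diag_mx (\row_i lam i)) T =
  diag_mx (\row_i (lam i ^+ 2 / gam i * (1 - expR (- (2 * T) * gam i)))).
Proof.
move=> gam0; rewrite /M_mx exprmx_diag invmx_diag; last first.
  by move=> i; rewrite mxE gt_eqF.
rewrite -linearZ/= expmx_diag -mulmxA.
rewrite mulmxA mulmx_diag mulmxBr mulmx1 mulmx_diag.
by apply/matrixP => i j; rewrite !mxE -mulrnBl; congr (_ *+ _); ring.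
Qed.

(** * The graph Laplacian and the existence of active lines *)

Lemma mul_incidence (N : nat) (G : network R N) (u : 'rV[R]_(1 + N))
    (l : 'I_#|lines G|) :
  (u *m (incidence_mx G)^T) 0 l = u 0 (enum_val l).1 - u 0 (enum_val l).2.
Proof.
have neq : (enum_val l).1 != (enum_val l).2.
  case: (enum_val l) (enum_valP l) => x y xy; apply/eqP => /= e; subst y.
  by have := lines_oriented xy; rewrite xy.
rewrite mxE (bigD1 (enum_val l).1)//= (bigD1 (enum_val l).2) 1?eq_sym//=.
rewrite !mxE eqxx eq_sym (negbTE neq) eqxx mulr1 mulrN1.
rewrite big1 ?addr0// => i /andP[i1 i2].
by rewrite !mxE (negbTE i1) (negbTE i2) mulr0.
Qed.

(** The form is the sum over the lines of weight times squared difference of [u]. If it vanishes,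
    [u] agrees at the two ends of every line, hence along every path of the connected graph. *)
Lemma laplacian_ker_const (N : nat) (G : network R N) (u : 'rV[R]_(1 + N)) :
  (u *m laplacian_mx G *m u^T) 0 0 = 0 -> forall i j, u 0 i = u 0 j.
Proof.
have -> : u *m laplacian_mx G *m u^T =
    (u *m (incidence_mx G)^T) *m weight_mx G *m (u *m (incidence_mx G)^T)^T.
  by rewrite /laplacian_mx trmx_mul trmxK !mulmxA.
rewrite quadratic_diag => /eqP; rewrite psumr_eq0; last first.
  by move=> l _; rewrite mxE mulr_ge0 ?sqr_ge0// ltW// weight_gt0.
move=> /allP u0.
have step x y : (x, y) \in lines G -> u 0 x = u 0 y.
  move=> xy; have := u0 (enum_rank_in xy (x, y)) (mem_index_enum _).
  rewrite /= mul_incidence enum_rankK_in// mxE mulf_eq0.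
  by rewrite (gt_eqF (weight_gt0 _)) orbF sqrf_eq0 subr_eq0 => /eqP.
move=> i j; have /connectP[p + ->] := lines_connected G i j.
elim: p i => //= x p IH i /andP[ix /IH <-].
by case/orP: ix => /step.
Qed.

(** A kernel vector, padded with 0 at node 0, has zero Laplacian form; it is therefore constant,
    equal to its value 0 at node 0. *)
Lemma Bhat_unitmx (N : nat) (G : network R N) : Bhat G \in unitmx.
Proof.
rewrite -row_free_unit; apply: inj_row_free => v vB.
have /laplacian_ker_const uc :
    (row_mx 0 v *m laplacian_mx G *m (row_mx 0 v)^T) 0 0 = 0 :> R.
  rewrite -[laplacian_mx G](@submxK _ 1 N 1 N) mul_row_block -/(Bhat G) vB.
  rewrite !mul0mx addr0 add0r tr_row_mx mul_row_col trmx0 mulmx0 mul0mx.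
  by rewrite addr0 mxE.
apply/rowP => i; have := uc (rshift 1 i) (lshift N 0).
by rewrite row_mxEr row_mxEl !mxE.
Qed.

Lemma diag_mx_mul_eq0 (n p : nat) (v : 'rV[R]_n) (Y : 'M[R]_(n, p)) :
  (forall i, v 0 i != 0) -> diag_mx v *m Y = 0 -> Y = 0.
Proof.
move=> v0 /matrixP vY; apply/matrixP => i j.
have := vY i j; rewrite mul_diag_mx !mxE => /eqP.
by rewrite mulf_eq0 (negbTE (v0 i)) => /eqP.
Qed.

(** If [Cmx G] were zero, cancelling the invertible diagonal factors would give
    [Ah *m invmx (Bhat G) *m P = 0]; multiplying by [Ah^T *m weight_mx G] would then give [P = 0],
    although [P] contains an identity block of positive size. *)
Lemma active_lines_neq0 (m d : nat) (G : network R (m + d)) :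
  (0 < m)%N -> exists k, active_lines G k.
Proof.
move=> m0; apply: contrapT => H.
have C0 : Cmx G = 0.
  apply/row_matrixP => k; rewrite row0; apply/eqP/negbNE/negP => kC.
  by apply: H; exists k.
(* [Ah] is the incidence matrix without node 0, and [P] selects the columns of the stochastic
   nodes. *)
pose Ah : 'M[R]_(#|lines G|, m + d) := rsubmx (incidence_mx G).
pose P : 'M[R]_(m + d, m) := col_mx 1%:M 0.
have AE : incidence_mx G = row_mx (lsubmx (incidence_mx G)) Ah.
  by rewrite hsubmxK.
have BE : Bhat G = Ah^T *m weight_mx G *m Ah.
  rewrite /Bhat /laplacian_mx [in LHS]AE tr_row_mx mul_col_mx mul_col_row.
  by rewrite block_mxKdr.
have CE : Cmx G = Lambda_mx G *m (weight_mx G *m (Ah *m (invmx (Bhat G) *m P))).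
  rewrite /Cmx /Cbar AE /Bbreve -mulmxA mul_row_block !mulmx0 !add0r.
  rewrite mul_mx_row row_mxKr !mulmxA.
  set K := (X in X *m P).
  by rewrite -[in RHS](hsubmxK K) /P mul_row_col mulmx1 mulmx0 addr0.
have /diag_mx_mul_eq0 :
    Lambda_mx G *m (weight_mx G *m (Ah *m (invmx (Bhat G) *m P))) = 0.
  by rewrite -CE.
move=> /(_ _)/diag_mx_mul_eq0 Y0.
have : P = 0.
  rewrite -(mulKVmx (Bhat_unitmx _ G) P) {1}BE -!mulmxA Y0 ?mulmx0// => i;
    rewrite mxE.
  - by rewrite gt_eqF// weight_gt0.
  - by rewrite gt_eqF// invr_gt0 Imax_gt0.
move=> /matrixP /(_ (lshift d (Ordinal m0)) (Ordinal m0)).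
rewrite col_mxEu !mxE eqxx => /eqP; apply/negP; exact: oner_neq0.
Qed.

(** * Cost of a path and displacement of a linear functional *)

Lemma integrable_of_sqr (a b : R) (f : R -> R) :
  measurable_fun `[a, b] f ->
  (\int[leb]_(s in `[a, b]) (f s ^+ 2)%:E < +oo)%E ->
  leb.-integrable `[a, b] (EFin \o f).
Proof.
move=> mf f2.
have If2 : leb.-integrable `[a, b] (EFin \o (fun s => f s ^+ 2)).
  apply/integrableP; split.
    by apply/measurable_EFinP; exact: measurable_funX.
  by under eq_integral => s _ do rewrite /= ger0_norm ?sqr_ge0//.
(* This dominates [f] because [|f| <= 1 + f ^+ 2], and the segment has finite length. *)
have I1 : leb.-integrable `[a, b] (EFin \o (fun s => 1 + f s ^+ 2)).
  apply: integrable_EFinD => //; apply: continuous_integrable_itv.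
  exact: cst_continuous.
apply: le_integrable I1 => //; first exact/measurable_EFinP.
move=> s _ /=; rewrite lee_fin.
rewrite (ger0_norm (_ : 0 <= 1 + f s ^+ 2)) ?addr_ge0 ?sqr_ge0//.
by rewrite -real_normK ?num_real//; have := sqr_ge0 (`|f s| - 1); nra.
Qed.

(* [u M_T u^T], which is twice the variance at time [T] of the linear functional
   [u] of the diffusion. *)
Definition ou_variance (m : nat) (gam lam : 'I_m -> R) (T : R)
    (u : 'rV[R]_m) : R :=
  \sum_i u 0 i ^+ 2 * (lam i ^+ 2 / gam i * (1 - expR (- (2 * T) * gam i))).

Lemma ou_variance_term_gt0 (gamma lambda T : R) : 0 < gamma -> 0 < T ->
  0 < lambda -> 0 < lambda ^+ 2 / gamma * (1 - expR (- (2 * T) * gamma)).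
Proof.
move=> g0 T0 l0; rewrite mulr_gt0 ?divr_gt0 ?exprn_gt0// subr_gt0 expR_lt1.
by rewrite mulNr oppr_lt0 !mulr_gt0.
Qed.

Lemma ou_variance_gt0 (m : nat) (gam lam : 'I_m -> R) (T : R) (u : 'rV[R]_m) :
  (forall i, 0 < gam i) -> (forall i, 0 < lam i) -> 0 < T -> u != 0 ->
  0 < ou_variance m gam lam T u.
Proof.
move=> gam0 lam0 T0 u0.
have v0 i := ou_variance_term_gt0 (gam i) (lam i) T (gam0 i) T0 (lam0 i).
have t0 i : 0 <= u 0 i ^+ 2 *
    (lam i ^+ 2 / gam i * (1 - expR (- (2 * T) * gam i))).
  by rewrite mulr_ge0 ?sqr_ge0 ?ltW.
rewrite lt_neqAle sumr_ge0// andbT eq_sym psumr_eq0//.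
apply: contra u0 => /allP H.
apply/eqP/rowP => i; have := H i (mem_index_enum _).
by rewrite mxE mulf_eq0 (gt_eqF (v0 i)) orbF sqrf_eq0 => /eqP.
Qed.

(** Sum of the one-coordinate bounds with multipliers [q * u 0 i]; the factor one half of the cost
    turns [2 * q] into [q] and the denominator 2 into 4. *)
Lemma Ipow_ou_ge (m : nat) (gam lam : 'I_m -> R) (T q t : R)
    (b l : 'I_m -> R -> R) (mu : 'cV[R]_m) (u : 'rV[R]_m) (g : R -> 'cV[R]_m) :
  (forall i, 0 < gam i) -> (forall i, 0 < lam i) ->
  (forall i x, b i x = gam i * (mu i 0 - x)) -> (forall i x, l i x = lam i) ->
  H1 T mu g -> t \in `[0, T] ->
  ((q * (u *m (g t - mu)) 0 0 - q ^+ 2 / 4 * ou_variance m gam lam T u)%:E <=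
   Ipow T b l g)%E.
Proof.
move=> gam0 lam0 bE lE [phi phiL2 gE] tT; rewrite /Ipow.
rewrite mxE /ou_variance !mulr_sumr -sumrB -sumEFin; apply: lee_sum => i _.
have Iphi : leb.-integrable `[0, T] (EFin \o (fun s => phi s i 0)).
  by have [] := phiL2 i; exact: integrable_of_sqr.
have := ou_energy_ge (gam i) (lam i) T t (q * u 0 i) (mu i 0)
  (fun s => phi s i 0)
  (fun s => g s i 0) (gam0 i) (lam0 i) tT Iphi (fun s sT => gE s sT i).
under [X in _ -> (_ <= _ * X)%E]eq_integral do rewrite bE lE.
move=> H; apply: le_trans (lee_wpmul2l _ H); last by rewrite lee_fin invr_ge0.
rewrite -EFinM lee_fin !mxE le_eqVlt; apply/orP; left; apply/eqP.
have -> : - (2 * T) * gam i = - (2 * gam i * T) by ring.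
by field; rewrite gt_eqF.
Qed.

(** The left side is maximal at [q = 2 * X / S], with value [X ^+ 2 / S]; this recovers the
    Cauchy-Schwarz bound. *)
Lemma norm_le_of_quadratic (X S I : R) : 0 < S ->
  (forall q, q * X - q ^+ 2 / 4 * S <= I) -> `|X| <= Num.sqrt (S * I).
Proof.
move=> S0 H; rewrite -sqrtr_sqr ler_wsqrtr//.
have := H (2 * X / S).
rewrite (_ : _ - _ = X ^+ 2 / S); last by field; rewrite gt_eqF.
by rewrite ler_pdivrMr// mulrC.
Qed.

(** * The decay rate and the region *)

Lemma mul_row_cV (m n : nat) (A : 'M[R]_(n, m)) (v : 'cV[R]_m) k :
  (A *m v) k 0 = (row k A *m v) 0 0.
Proof. by rewrite -row_mul [RHS]mxE. Qed.

Section Rate.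
Context (m d : nat) (G : network R (m + d)) (T : R) (T0 : 0 < T).
Context (b l : 'cV[R]_m -> 'I_m -> R -> R) (gam lam : 'I_m -> R).
Context (gam0 : forall i, 0 < gam i) (lam0 : forall i, 0 < lam i).
Context (bE : forall mu i x, b mu i x = gam i * (mu i 0 - x)).
Context (lE : forall mu i x, l mu i x = lam i).
Local Notation S k := (ou_variance m gam lam T (row k (Cmx G))).

Lemma current_shift (mubar : 'cV[R]_(m + d)) (v : 'cV[R]_m) k :
  (y_of G mubar + Cmx G *m v) k 0 =
  nu_of G mubar k 0 + (row k (Cmx G) *m (v - mu_of mubar)) 0 0.
Proof.
have -> : (row k (Cmx G) *m (v - mu_of mubar)) 0 0 =
    (Cmx G *m v) k 0 - (Cmx G *m mu_of mubar) k 0.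
  by rewrite -mul_row_cV mulmxBr [LHS]mxE; congr (_ + _); rewrite [LHS]mxE.
rewrite /nu_of.
generalize (Cmx G *m v) (Cmx G *m mu_of mubar) (y_of G mubar) => A B Y.
by rewrite !mxE; ring.
Qed.

(** A path of cost [I < E] moves an active line [k] by at most [sqrt (S k * I)], too little to reach
    1 in absolute value, while an inactive line keeps its initial current, which is strictly below 1
    by admissibility. *)
Lemma Icur_ou_ge (mubar : 'cV[R]_(m + d)) (E : R) : admissible G mubar ->
  (forall k, active_lines G k ->
     `|nu_of G mubar k 0| <= 1 - Num.sqrt (E * S k)) ->
  (E%:E <= Icur T G b l mubar)%E.
Proof.
move=> [adm1 adm2] hE; apply: le_ereal_inf_tmp => _ [g [Hg /= supg] <-].
rewrite leNgt; apply/negP => IE.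
have Ige q u t := Ipow_ou_ge m gam lam T q t (b (mu_of mubar)) (l (mu_of mubar))
  (mu_of mubar) u g gam0 lam0 (bE _) (lE _) Hg.
(* Nonnegativity of the cost is the quadratic bound at [q = 0]. *)
have I0 : (0 <= Ipow T (b (mu_of mubar)) (l (mu_of mubar)) g)%E.
  have T1 : T \in `[0, T] by rewrite in_itv/= lexx ltW.
  by have := Ige 0 0 T T1; rewrite mul0r expr0n/= !mul0r subrr.
move: IE Ige I0; set I := Ipow _ _ _ _; case: I => [I | |]; last 2 first.
- by rewrite ltNge leey.
- by move=> _ _; rewrite leeNy_eq.
rewrite lte_fin lee_fin => IE Ige I0.
pose bound k := `|nu_of G mubar k 0| +
  (if row k (Cmx G) == 0 then 0 else Num.sqrt (S k * I)).
have bound_lt1 k : bound k < 1.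
  rewrite /bound; case: ifPn => kC.
    by rewrite addr0; apply: adm2; rewrite /active_lines /= kC.
  have Sk0 : 0 < S k by exact: ou_variance_gt0.
  rewrite -ltrBrDr; apply: le_lt_trans (hE k kC) _.
  rewrite ltrD2l ltrN2 mulrC ltr_sqrt ?ltr_pM2r// mulr_gt0//.
  exact: le_lt_trans I0 IE.
have bound_ge t k : t \in `[0, T] ->
    `|(y_of G mubar + Cmx G *m g t) k 0| <= bound k.
  move=> tT; rewrite current_shift; apply: le_trans (ler_normD _ _) _.
  rewrite lerD2l; case: ifPn => [/eqP ->|kC].
    by rewrite mul0mx mxE normr0.
  apply: norm_le_of_quadratic; first exact: ou_variance_gt0.
  by move=> q; have := Ige q (row k (Cmx G)) t tT; rewrite lee_fin.
(* Strict bounds at each time would not exclude a supremum equal to 1. These do not depend on [t],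
   and a maximum of finitely many of them and the default 0 stays below 1. *)
pose B := \big[Num.max/0]_k bound k.
have : (supnorm T (fun t => (y_of G mubar + Cmx G *m g t)%R) <= B%:E)%E.
  apply: ge_ereal_sup => _ [t [k [tT ->]]]; rewrite lee_fin.
  by apply: le_trans (bound_ge t k tT) _; exact: le_bigmax.
move=> /(le_trans supg); rewrite lee_fin leNgt => /negP; apply.
by apply: bigmax_lt => // k _; exact: bound_lt1.
Qed.

(** The competitor is the extremal path that brings line [k] from its initial current to 1 or -1,
    whichever is nearer, exactly at time [T]. *)
Lemma Icur_ou_le (mubar : 'cV[R]_(m + d)) k : admissible G mubar ->
  active_lines G k ->
  (Icur T G b l mubar <= ((1 - `|nu_of G mubar k 0|) ^+ 2 / S k)%:E)%E.
Proof.
move=> [adm1 _] kC; have Sk0 : 0 < S k by exact: ou_variance_gt0.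
set nu := nu_of G mubar k 0; set u := row k (Cmx G).
(* A sign that is 1 at zero, so that [s ^+ 2 = 1] always holds. *)
pose s : R := if 0 <= nu then 1 else -1.
(* [kap] makes the displacement at time [T] exactly [s * (1 - |nu|)]. *)
pose kap := 2 * s * (1 - `|nu|) / S k.
(* This makes the control of coordinate [i] at time [t] equal to [kap * u 0 i * lam i ^+ 2 * expR (-
   gam i * (T - t))], the equality case. *)
pose a i := kap * u 0 i * lam i ^+ 2 * expR (- gam i * T).
pose g t : 'cV[R]_m := \col_i ou_path (gam i) (a i) (mu_of mubar i 0) t.
have gE t i : g t i 0 = ou_path (gam i) (a i) (mu_of mubar i 0) t.
  by rewrite mxE.
have s2 : s ^+ 2 = 1 by rewrite /s; case: ifP; rewrite ?sqrrN expr1n.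
have Hg : H1 T (mu_of mubar) g.
  pose phi t : 'cV[R]_m := \col_i ou_speed (gam i) (a i) t.
  have phiE t i : phi t i 0 = ou_speed (gam i) (a i) t by rewrite mxE.
  exists phi => [i|t /[!in_itv]/= /andP[t0 tT] i]; last first.
    rewrite gE ou_pathE//.
    by congr (_ + _); apply: eq_Rintegral => r _; rewrite phiE.
  rewrite (_ : (fun s => phi s i 0) = ou_speed (gam i) (a i)); last first.
    by apply/funext => t; rewrite phiE.
  split.
    apply: measurable_funS (continuous_measurable_fun _) => //.
    exact: continuous_ou_speed.
  under eq_integral do rewrite phiE.
  rewrite EFin_Rintegral ?ltey//; apply: continuous_integrable_itv => t.
  by apply: cvgM; exact: continuous_ou_speed.
have gT : (u *m (g T - mu_of mubar)) 0 0 = s * (1 - `|nu|).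
  transitivity (kap / 2 * S k); last by rewrite /kap; field; rewrite gt_eqF.
  rewrite mxE /ou_variance mulr_sumr; apply: eq_bigr => i _.
  rewrite !mxE /ou_path /a /u !mxE.
  (* Once all exponentials are powers of [expR (- gam i * T)], the identity is rational. *)
  have -> : - (2 * T) * gam i = - gam i * T + - gam i * T by ring.
  have -> : gam i * T = - (- gam i * T) by ring.
  rewrite expRD (expRN (- gam i * T)).
  by field; rewrite !gt_eqF ?expR_gt0.
have Ig : Ipow T (b (mu_of mubar)) (l (mu_of mubar)) g =
    ((1 - `|nu|) ^+ 2 / S k)%:E.
  transitivity (kap ^+ 2 / 4 * S k)%:E; last first.
    by congr EFin; rewrite /kap !exprMn s2; field; rewrite gt_eqF.
  rewrite /Ipow /ou_variance mulr_sumr -sumEFin; apply: eq_bigr => i _.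
  under eq_integral do rewrite bE lE.
  rewrite (_ : (fun s => g s i 0) =
      ou_path (gam i) (a i) (mu_of mubar i 0)); last first.
    by apply/funext => t; rewrite gE.
  under eq_integral do rewrite gE.
  rewrite ou_path_energy// ?ltW// -EFinM; congr EFin.
  rewrite /a /u !mxE.
  have -> : - (2 * T) * gam i = - gam i * T + - gam i * T by ring.
  have -> : 2 * gam i * T = - (- gam i * T) + - (- gam i * T) by ring.
  rewrite !expRD (expRN (- gam i * T)).
  by field; rewrite !gt_eqF ?expR_gt0.
rewrite -Ig; apply: ereal_inf_lbound; exists g => //; split => //=.
apply: ereal_sup_ubound; exists T, k; split; first by rewrite in_itv/= lexx ltW.
congr EFin; rewrite current_shift -/u -/nu gT /s.
have nu1 : `|nu| <= 1 by exact: adm1.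
case: ifPn => nu0.
  by rewrite mul1r (ger0_norm nu0) addrC subrK normr1.
have nu0' : nu < 0 by rewrite ltNge.
by rewrite (ltr0_norm nu0') (_ : _ + _ = -1) ?normrN1//; ring.
Qed.

(** With [E = eps * ln (1 / p)], the upper bound on the rate at each active line gives one
    inclusion, and the lower bound under all the line conditions gives the other. *)
Lemma region_ouE (eps p : R) : (0 < m)%N -> 0 < eps -> 0 < p -> p < 1 ->
  region T G b l eps p =
    \bigcap_(k in active_lines G)
      [set mubar | admissible G mubar /\
         `|nu_of G mubar k 0| <= 1 - Num.sqrt (eps * ln (1 / p) * S k)].
Proof.
move=> m0 eps0 p0 p1.
have lnE : - eps * ln p = eps * ln (1 / p).
  by rewrite div1r lnV ?posrE// mulrN mulNr.
apply/seteqP; split=> mubar.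
  move=> [adm Iadm] k kC; split=> //.
  have Sk0 : 0 < S k by exact: ou_variance_gt0.
  have := le_trans Iadm (Icur_ou_le mubar k adm kC).
  rewrite lnE lee_fin ler_pdivlMr// => H.
  (* This sign allows taking square roots in [E * S k <= (1 - |nu|) ^+ 2]. *)
  have nu1 : 0 <= 1 - `|nu_of G mubar k 0| by rewrite subr_ge0; exact: adm.1.
  rewrite lerBrDr addrC -lerBrDr.
  by rewrite -[leRHS]ger0_norm// -sqrtr_sqr ler_wsqrtr.
(* An intersection over no line would be the whole space; an active line is what supplies
   admissibility. *)
move=> H; have [k0 k0C] := active_lines_neq0 m d G m0.
have [adm _] := H k0 k0C; split=> //; rewrite lnE.
by apply: Icur_ou_ge => // k kC; have [] := H k kC.
Qed.

End Rate.

End OrnsteinUhlenbeck.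

(** * The region in matrix form, and the case of a scalar [D] *)

Theorem mainTheorem4 (R : realType) (m d : nat) (m_gt0 : (0 < m)%N)
    (G : network R (m + d)) (T eps p : R)
    (T_gt0 : 0 < T) (eps_gt0 : 0 < eps) (p_gt0 : 0 < p) (p_lt1 : p < 1)
    (b l : 'cV[R]_m -> 'I_m -> R -> R) (gam lam : 'I_m -> R)
    (gam_gt0 : forall i, 0 < gam i) (lam_gt0 : forall i, 0 < lam i)
    (b_OU : forall mu i x, b mu i x = gam i * (mu i 0 - x))
    (l_OU : forall mu i x, l mu i x = lam i) :
  let D := diag_mx (\row_i gam i) in
  let L := diag_mx (\row_i lam i) in
  let C k := row k (Cmx G) in
  region T G b l eps p =
    \bigcap_(k in active_lines G)
      [set mubar | admissible G mubar /\
         `|nu_of G mubar k 0| <=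
           1 - Num.sqrt (eps * ln (1 / p) *
                         (C k *m M_mx D L T *m (C k)^T) 0 0)]
  /\
  (forall gamma : R, 0 < gamma -> D = gamma%:M ->
   region T G b l eps p =
     \bigcap_(k in active_lines G)
       [set mubar | admissible G mubar /\
          let sigma2 := (C k *m L ^+ 2 *m (C k)^T) 0 0 in
          let beta := Num.sqrt ((1 - expR (- (2 * gamma * T))) *
                                (eps * ln (1 / p) * sigma2) / gamma) in
          `|nu_of G mubar k 0| <= 1 - beta]).
Proof.
move=> D L C.
have regE := region_ouE m d G T T_gt0 b l gam lam gam_gt0 lam_gt0 b_OU l_OU
  eps p m_gt0 eps_gt0 p_gt0 p_lt1.
have SE k :
    (C k *m M_mx D L T *m (C k)^T) 0 0 = ou_variance m gam lam T (C k).
  rewrite M_mx_diag// quadratic_diag.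
  by apply: eq_bigr => i _; rewrite [in X in _ * X]mxE.
have sigmaE k : (C k *m L ^+ 2 *m (C k)^T) 0 0 =
    \sum_i C k 0 i ^+ 2 * lam i ^+ 2.
  rewrite exprmx_diag quadratic_diag; apply: eq_bigr => i _.
  by congr (_ * _); rewrite !mxE.
split=> [|gamma gamma_gt0 DE]; rewrite regE; apply: eq_bigcapr => k _.
  by rewrite SE.
(* The diagonal of [D] gives equal rates, so the factor [(1 - expR (- (2 * gamma * T))) / gamma]
   comes out of the sum. *)
have gamE i : gam i = gamma.
  by move/matrixP: DE => /(_ i i); rewrite !mxE eqxx !mulr1n.
rewrite /= sigmaE.
rewrite (_ : (1 - _) * _ / gamma =
  eps * ln (1 / p) * ou_variance m gam lam T (C k))//.
rewrite /ou_variance !mulr_sumr mulr_suml; apply: eq_bigr => i _.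
rewrite gamE (_ : - (2 * T) * gamma = - (2 * gamma * T)); last by ring.
by field; rewrite gt_eqF.
Qed.
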